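(* In the Karlin occupancy scheme with deterministic probabilities $(p_k)_{k\in\mathbb{N}}$, let $\rho(x):=\#\{k\in\mathbb{N}:p_k\ge 1/x\}$ for $x>0$, and let $K_n(t)$ be the number of occupied boxes containing at most $[n^t]$ balls after $n$ balls have been placed. Then $$\mathbb{E}\sup_{t\in[0,1]}\Big|K_n(t)-\big(\rho(n)-\rho(n^{(1-t)-})\big)\Big|\le 6\Big(\rho(n)-\rho\big(x_0^{-1}n(\log n)^{-2}\big)\Big)+\frac{3\rho(n)}{\log n}+\int_1^\infty t^{-2}\big(\rho(nt)-\rho(n)\big)\,dt+2\sup_{t\in[0,1]}\Big(\rho(en^{1-t})-\rho(e^{-1}n^{1-t})\Big),$$ where $x_0>1$ denotes an absolute constant that does not depend on $n$, nor on $(p_j)_{j\in\mathbb{N}}$.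
   Context: Karlin occupancy scheme: given a (deterministic) probability vector $(p_k)_{k\in\mathbb{N}}$, $\mathbb{N}=\{1,2,\ldots\}$, balls are placed independently into an infinite array of boxes $1,2,\ldots$, each ball going into box $k$ with probability $p_k$. $Z_{n,j}$ is the number of balls in box $j$ after $n$ balls have been placed, and $K_n(t):=\sum_{j\ge1}\mathbf{1}_{\{Z_{n,j}\in[1,n^t]\}}$ for $t\in[0,1]$. $[x]$ denotes the integer part of $x$. $\rho(n^{(1-t)-})$ denotes the left limit of $\rho$ at the point $n^{1-t}$, i.e. $\rho(n^{(1-t)-})=\#\{k\in\mathbb{N}:p_k>n^{t-1}\}$. *)

(* Defs.v *)
From HB Require Import structures.
From mathcomp Require Import all_boot all_order all_algebra finmap.
From mathcomp Require Import all_classical all_reals all_analysis.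

Set Implicit Arguments.
Unset Strict Implicit.
Unset Printing Implicit Defensive.

Import Order.TTheory GRing.Theory Num.Theory.
Import numFieldNormedType.Exports.

Local Open Scope classical_set_scope.
Local Open Scope ring_scope.

(* Boxes are indexed by nat: box j of the text is index j.-1 here. *)

Definition probability_vector (R : realType) (p : nat -> R) : Prop :=
  (forall k, 0 <= p k) /\ (\sum_(0 <= k <oo) (p k)%:E = 1%:E)%E.

(* The set is finite for a probability vector p and x > 0, so the fset_set
   default for infinite sets is never used there. *)
Definition rho (R : realType) (p : nat -> R) (x : R) : R :=
  #|` fset_set [set k | x^-1 <= p k] |%:R.

Definition rho_left (R : realType) (p : nat -> R) (x : R) : R :=
  lim (rho p y @[y --> x^'-]).

Definition mutually_independent d (T : measurableType d) (R : realType)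
    (P : probability T R) d' (S : measurableType d') (X : nat -> T -> S) :=
  forall (J : {fset nat}) (A : nat -> set S), (forall i, measurable (A i)) ->
    P (\bigcap_(i in [set` J]) (X i @^-1` A i)) =
    (\prod_(i <- J) P (X i @^-1` A i))%E.

(* X i is the box that receives the ball number i.+1. *)
Definition karlin_scheme d (T : measurableType d) (R : realType)
    (P : probability T R) (p : nat -> R) (X : nat -> T -> nat) : Prop :=
  [/\ forall i, measurable_fun setT (X i),
      forall i k, P (X i @^-1` [set k]) = (p k)%:E
    & mutually_independent P X].

Definition ball_count (T : Type) (X : nat -> T -> nat) (n j : nat) (w : T) : nat :=
  (\sum_(i < n) (X i w == j))%N.

(* At most n boxes are occupied, so the set is finite. *)
Definition occupied_upto (R : realType) (T : Type) (X : nat -> T -> nat)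
    (n : nat) (t : R) (w : T) : R :=
  #|` fset_set [set j | (1 <= ball_count X n j w)%N /\
                        (ball_count X n j w)%:R <= n%:R `^ t] |%:R.

Lemma finite_box_ge (R : realType) (p : nat -> R) (x : R) :
  probability_vector p -> 0 < x -> finite_set [set k | x <= p k].
Proof.
move=> [p0 p1] x0.
have : (fun n => (\sum_(0 <= k < n) (p k)%:E)%E) @ \oo --> (1%:E : \bar R).
  rewrite -p1; apply: is_cvg_nneseries => k _ _; by rewrite lee_fin.
move=> /fine_cvgP [_ /= h].
have hc : cvgn (series p).
  apply/cvg_ex; exists 1; apply: cvg_trans h; apply: near_eq_cvg; near=> n.
  by rewrite /= sumEFin.
have := cvg_series_cvg_0 hc => /cvgrPdist_lt /(_ x x0) [N _ hN].
apply: (@sub_finite_set _ _ `I_N); last exact: finite_II.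
move=> k /= xp; rewrite ltnNge; apply/negP => Nk.
have := hN k Nk; rewrite /= sub0r normrN ger0_norm// ltNge xp//.
Unshelve. all: by end_near.
Qed.

(* The left limit in rho_left exists for every x > 0 and has the expected value. *)
Lemma rho_leftE (R : realType) (p : nat -> R) (x : R) :
  probability_vector p -> 0 < x ->
  rho_left p x = #|` fset_set [set k | x^-1 < p k] |%:R.
Proof.
move=> hp x0; rewrite /rho_left; apply: (@lim_near_cst R^o) => //.
pose A := fset_set [set k | x^-1 < p k].
have fA : finite_set [set k | x^-1 < p k].
  apply: sub_finite_set (finite_box_ge hp (_ : 0 < x^-1)); last by rewrite invr_gt0.
  by move=> k /= /ltW.
have h : \forall y \near x^'-, forall k : A, y^-1 <= p (val k).
  apply: filter_forall => /= k.
  have xk : x^-1 < p (val k) by have := valP k; rewrite /A in_fset_set// inE.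
  have pk : 0 < p (val k) by apply: lt_trans xk; rewrite invr_gt0.
  near=> y.
  have y0 : 0 < y by near: y; apply: nbhs_left_gt.
  rewrite invf_ple ?posrE//; near: y; apply: nbhs_left_ge.
  by rewrite invf_plt ?posrE.
near=> y.
have y0 : 0 < y by near: y; apply: nbhs_left_gt.
have yx : y < x by near: y; exact: nbhs_left_lt.
have hy : forall k : A, y^-1 <= p (val k) by near: y.
rewrite /rho; congr (#|` fset_set _ |%:R); apply/seteqP; split => k /=.
  by apply: lt_le_trans; rewrite ltf_pV2 ?posrE.
move=> xk; have kA : k \in A by rewrite /A in_fset_set// inE.
exact: (hy [` kA]%fset).
Unshelve. all: by end_near.
Qed.

(* Main.v *)
Require Import Defs.
From HB Require Import structures.
From mathcomp Require Import all_boot all_order all_algebra finmap.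
From mathcomp Require Import all_classical all_reals all_analysis.
From mathcomp Require Import measurable_realfun ring lra.

Set Implicit Arguments.
Unset Strict Implicit.
Unset Printing Implicit Defensive.

Import Order.TTheory GRing.Theory Num.Theory.
Import numFieldNormedType.Exports.

Local Open Scope classical_set_scope.
Local Open Scope ring_scope.

(** Write mu_k = n p_k for the mean number of balls in box k and Z_k for the
    actual number. The centering rho(n) - rho(n^(1-t)-) is the number of k with
    1 <= mu_k <= n^t, while K_n(t) is the number of k with 1 <= Z_k <= n^t, so
    the claim compares two cardinalities, and the distance between them is at
    most the size of the symmetric difference. Put M = x0 (log n)^2. A box k in
    the symmetric difference for some t falls into one of three classes:
    - 1 <= mu_k < M: there are rho(n) - rho(n / M) such boxes, whatever t is;
    - mu_k < 1 and k is occupied, or mu_k >= M and Z_k misses mu_k by at least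
      mu_k / 2: call such a box exceptional. This class is random but does not
      depend on t;
    - otherwise Z_k and mu_k are within a factor 2, hence a factor e, of each
      other, and n^t lies between them, so that n^t / e <= mu_k < e n^t. There
      are rho(e n^(1-t)) - rho(n^(1-t) / e) such boxes.
    Thus the supremum over t is at most the number of exceptional boxes plus two
    deterministic terms ([dist_counts_le]), and only the expected number of
    exceptional boxes remains ([expected_exceptional_le]). A box with mu_k < 1
    is occupied with probability at most mu_k by Markov's inequality, and the
    sum of these mu_k is the integral in the bound: write mu_k as the integral
    of t^-2 over t >= 1 / mu_k and exchange sum and integral
    ([small_mass_le_integral]). A box with mu_k >= M is exceptional with
    probability at most 4 / mu_k <= 4 / M by Chebyshev's inequality
    ([prob_deviation_le]), which adds up to at most 4 rho(n) / M. Since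
    log n >= 1/2 for n >= 2, the choice x0 = 4 gives both M >= 1 and
    4 / M = (log n)^-2 <= 3 / log n. *)

(** * Cardinalities of finite sets *)

Local Notation ncard A := (#|` fset_set A|).

Lemma card_subset (T : choiceType) (A B : set T) :
  finite_set B -> A `<=` B -> (ncard A <= ncard B)%N.
Proof.
move=> fB AB; have fA := sub_finite_set AB fB.
by apply/fsubset_leq_card; rewrite -fset_set_sub.
Qed.

Lemma card_setU_le (T : choiceType) (A B : set T) :
  finite_set A -> finite_set B -> (ncard (A `|` B) <= ncard A + ncard B)%N.
Proof. by move=> fA fB; rewrite fset_setU// cardfsU leq_subr. Qed.

Lemma card_setD (R : pzRingType) (T : choiceType) (A B : set T) :
  finite_set A -> B `<=` A -> (ncard (A `\` B))%:R = (ncard A)%:R - (ncard B)%:R :> R.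
Proof.
move=> fA BA; have fB := sub_finite_set BA fA.
rewrite fset_setD// cardfsDS -?fset_set_sub//.
by rewrite natrB//; exact: card_subset.
Qed.

Lemma dist_card_le (R : realDomainType) (T : choiceType) (A B C : set T) :
  finite_set A -> finite_set B -> finite_set C ->
  A `\` B `<=` C -> B `\` A `<=` C ->
  `|(ncard A)%:R - (ncard B)%:R| <= (ncard C)%:R :> R.
Proof.
move=> fA fB fC AB BA.
have aux (E F : set T) : finite_set E -> finite_set F -> E `\` F `<=` C ->
    (ncard E)%:R <= (ncard F)%:R + (ncard C)%:R :> R.
  move=> fE fF EF; rewrite -natrD ler_nat.
  apply: (leq_trans _ (card_setU_le fF fC)); apply: card_subset.
    by rewrite finite_setU.
  by move=> x Ex; have [Fx|nFx] := pselect (F x); [left|right; exact: EF].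
by rewrite ler_distlC lerBlDr !aux.
Qed.

(** Turns a random cardinality into a series of indicators, whose expectation
    can be taken term by term. *)
Lemma card_nneseries (R : realType) (A : set nat) : finite_set A ->
  (ncard A)%:R%:E = (\sum_(0 <= k <oo) (\1_A k : R)%:E)%E.
Proof.
move=> fA; rewrite nneseries_esumT; last by move=> k; rewrite lee_fin.
under eq_esum do rewrite indicE.
rewrite (_ : (fun i : nat => _) =
             (fun i => if i \in A then (1%:E : \bar R) else 0%E)); last first.
  by apply/funext => k; case: (k \in A).
rewrite -esum_mkcond esum_fset// fsbig_finite//=.
by rewrite sumEFin card_fset_sum1 natr_sum.
Qed.

(** * The pathwise comparison *)

(** The boxes whose contribution is controlled in expectation only: the counts
    [Z] differ from their means [mu] in a way that no deterministic condition
    on [mu] accounts for. *)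
Definition exceptional (R : realType) (mu : nat -> R) (M : R) (Z : nat -> nat) :
    set nat :=
  [set j | mu j < 1 /\ (0 < Z j)%N \/
           M <= mu j /\ mu j <= 2 * `|(Z j)%:R - mu j|].

Lemma finite_exceptional (R : realType) (mu : nat -> R) (M : R) (Z : nat -> nat) :
  finite_set [set j | M <= mu j] -> finite_set [set j | (0 < Z j)%N] ->
  finite_set (exceptional mu M Z).
Proof.
move=> fmu fZ; apply: (@sub_finite_set _ _ ([set j | M <= mu j] `|` [set j | (0 < Z j)%N])).
  by move=> j [[_ ?]|[? _]]; [right|left].
by rewrite finite_setU.
Qed.

Lemma expR1_ge2 (R : realType) : 2 <= expR 1 :> R.
Proof. by apply: le_trans (expR_ge1Dx 1); lra. Qed.

(** A box with [mu j < 1] that is not exceptional is empty and enters neither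
    count. One with [M <= mu j] that is not exceptional satisfies
    [mu j / 2 < Z j < 3 / 2 * mu j], so the two counts can disagree on [j] only
    if [s] lies between [Z j] and [mu j], hence only if [mu j] is within a factor
    [expR 1] of [s]. The right-hand side depends on [s] only through the last
    term, which makes the bound uniform. *)
Lemma dist_counts_le (R : realType) (mu : nat -> R) (M s : R) (Z : nat -> nat) :
  (forall y, 0 < y -> finite_set [set j | y <= mu j]) ->
  finite_set [set j | (0 < Z j)%N] -> 1 <= M -> 1 <= s ->
  `|(ncard [set j | (1 <= Z j)%N /\ (Z j)%:R <= s])%:R -
    ((ncard [set j | 1 <= mu j])%:R - (ncard [set j | s < mu j])%:R)|
  <= (ncard (exceptional mu M Z))%:R
     + ((ncard [set j | 1 <= mu j])%:R - (ncard [set j | M <= mu j])%:R)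
     + ((ncard [set j | (expR 1)^-1 * s <= mu j])%:R
        - (ncard [set j | expR 1 * s <= mu j])%:R) :> R.
Proof.
move=> fmu fZ M1 s1; have e2 := @expR1_ge2 R.
have e0 : 0 < (expR 1 : R) by lra.
have ei2 : (expR 1 : R)^-1 <= 2^-1 by rewrite lef_pV2// posrE; lra.
have ei0 : 0 < (expR 1 : R)^-1 by rewrite invr_gt0.
have es0 : 0 < (expR 1)^-1 * s by apply: mulr_gt0 => //; lra.
have f1 : finite_set [set j | 1 <= mu j] by apply: fmu.
have fM : finite_set [set j | M <= mu j] by apply: fmu; lra.
have fe := fmu _ es0.
have fX := finite_exceptional fM fZ.
pose B := [set j | 1 <= mu j] `\` [set j | s < mu j].
pose D := [set j | 1 <= mu j] `\` [set j | M <= mu j].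
pose S := [set j | (expR 1)^-1 * s <= mu j] `\` [set j | expR 1 * s <= mu j].
rewrite -(@card_setD _ _ _ [set j | s < mu j] f1); last first.
  by move=> j /= /ltW; exact: le_trans.
rewrite -(@card_setD _ _ _ [set j | M <= mu j] f1); last first.
  by move=> j /= h; apply: le_trans h.
rewrite -(@card_setD _ _ _ [set j | expR 1 * s <= mu j] fe); last first.
  by move=> j /= h; apply: le_trans h; apply: ler_wpM2r; lra.
rewrite -/B -/D -/S.
set A := [set j | _ /\ _].
have fB : finite_set B by exact: finite_setD.
have fD : finite_set D by exact: finite_setD.
have fS : finite_set S by exact: finite_setD.
have fA : finite_set A by apply: sub_finite_set fZ => j [].
have fXD : finite_set (exceptional mu M Z `|` D) by rewrite finite_setU.
apply: (@le_trans _ _ (ncard (exceptional mu M Z `|` D `|` S))%:R); last first.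
  rewrite -!natrD ler_nat; apply: (leq_trans (card_setU_le _ _)) => //.
  by rewrite leq_add2r; exact: card_setU_le.
have key j : 1 <= mu j -> (Z j = 0%N \/ s < (Z j)%:R /\ mu j <= s \/
    (Z j)%:R <= s /\ s < mu j) -> (exceptional mu M Z `|` D `|` S) j.
  move=> mu1 h.
  have [Mmu|muM] := leP M (mu j); last first.
    by left; right; split=> //=; apply/negP; rewrite -ltNge.
  have [dev|ndev] := leP (mu j) (2 * `|(Z j)%:R - mu j|).
    by left; left; right.
  right.
  have [lo up] : (mu j < 2 * (Z j)%:R /\ 2 * (Z j)%:R < 3 * mu j).
    have : `|(Z j)%:R - mu j| < mu j / 2 by rewrite ltr_pdivlMr//; lra.
    by rewrite ltr_distl; lra.
  have es : (expR 1)^-1 * s <= 2^-1 * s by apply: ler_wpM2r; lra.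
  have es' : 2 * s <= expR 1 * s by apply: ler_wpM2r; lra.
  case: h => [Z0|[[sZ mus]|[Zs smu]]].
  - by exfalso; rewrite Z0 in lo; lra.
  - by split => /=; [lra|apply/negP; rewrite -ltNge; lra].
  - by split => /=; [lra|apply/negP; rewrite -ltNge; lra].
apply: dist_card_le => //; first by rewrite finite_setU.
- move=> j [[Z1 Zs] nB].
  have [mu1|mu1] := leP 1 (mu j); last by left; left; left.
  apply: key => //; right; right; split => //.
  by rewrite ltNge; apply/negP => mus; apply: nB; split => //=; apply/negP; rewrite -leNgt.
- move=> j [[/= mu1 /negP]]; rewrite -leNgt => mus nA.
  apply: key => //.
  have [->|Z0] := eqVneq (Z j) 0%N; first by left.
  right; left; split => //; rewrite ltNge; apply/negP => Zs; apply: nA.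
  by split => //; rewrite lt0n.
Qed.

(** * Moments of the number of balls in a box *)

(** The integral of a nonnegative function is a supremum over the simple
    functions below it, which makes it monotone on nonmeasurable functions too.
    A supremum over uncountably many [t] can thus be bounded directly. *)
Lemma ge0_le_integralT d (T : measurableType d) (R : realType)
    (m : {measure set T -> \bar R}) (f g : T -> \bar R) :
  (forall x, (0 <= f x)%E) -> (forall x, (f x <= g x)%E) ->
  (\int[m]_x f x <= \int[m]_x g x)%E.
Proof.
move=> f0 fg; rewrite !ge0_integralTE//; last first.
  by move=> x; exact: le_trans (fg x).
apply: ereal_sup_le => _ [h /= hf <-]; exists h => //= x.
exact: le_trans (fg x).
Qed.

Section ball_count_moments.
Context d (T : measurableType d) (R : realType) (P : probability T R).
Variables (p : nat -> R) (X : nat -> T -> nat).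
Hypothesis hX : karlin_scheme P p X.
Variables n j : nat.

Let hit i := X i @^-1` [set j].

Let mhit i : measurable (hit i).
Proof. by case: hX => mX _ _; rewrite -[hit i]setTI; exact: mX. Qed.

Let Phit i : P (hit i) = (p j)%:E.
Proof. by case: hX => _ + _; exact. Qed.

Lemma ball_countE w : (ball_count X n j w)%:R = \sum_(i < n) (\1_(hit i) w : R).
Proof.
rewrite natr_sum; apply: eq_bigr => i _; rewrite indicE /hit.
by congr (nat_of_bool _)%:R; apply/eqP/idP; rewrite inE.
Qed.

(** The discrete sigma-algebra on [nat] makes every event about a single count
    measurable. *)
Lemma measurable_ball_count (Q : set nat) :
  measurable [set w | Q (ball_count X n j w)].
Proof.
have mZ : measurable_fun setT (ball_count X n j).
  case: hX => mX _ _; rewrite /ball_count.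
  elim: (n) => [|k IH]; first by under eq_fun do rewrite big_ord0; exact: measurable_cst.
  under eq_fun do rewrite big_ord_recr /=.
  apply: measurable_fun_addn => //.
  by apply: (measurableT_comp (f := fun x : nat => (x == j) : nat)).
by rewrite -[X in measurable X]setTI; exact: (mZ measurableT Q).
Qed.

Let mhitE i : measurable_fun setT (fun w => (\1_(hit i) w : R)%:E).
Proof. by apply/measurable_EFinP; exact: measurable_indic. Qed.

Lemma measurable_ball_count_EFin (f : nat -> R) :
  measurable_fun setT (fun w => (f (ball_count X n j w))%:E).
Proof.
apply/measurable_EFinP => _ A mA; rewrite setTI.
exact: (measurable_ball_count (f @^-1` A)).
Qed.

Lemma ball_count_mean :
  (\int[P]_w ((ball_count X n j w)%:R : R)%:E = (n%:R * p j)%:E)%E.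
Proof.
under eq_integral do rewrite ball_countE -sumEFin.
rewrite (ge0_integral_sum P measurableT (fun i : 'I_n => mhitE i)); last first.
  by move=> i w _; rewrite lee_fin.
rewrite (eq_bigr (fun=> (p j)%:E)) => [|i _]; last first.
  by rewrite integral_indic ?setIT//; exact: Phit.
by rewrite sumEFin sumr_const card_ord mulr_natl.
Qed.

Lemma prob_two_hits i l : i != l -> P (hit i `&` hit l) = (p j ^+ 2)%:E.
Proof.
move=> il; case: hX => _ _ /(_ [fset i; l]%fset (fun _ => [set j])) /=.
rewrite big_fsetU1 ?inE//= big_seq_fset1 set_fsetU !set_fset1 bigcap_setU !bigcap_set1.
by rewrite -/(hit i) -/(hit l) !Phit => ->//; rewrite -EFinM.
Qed.

(** Expand the square into pairs of balls: distinct balls are independent and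
    contribute [p j ^+ 2] each, and each of the [n] diagonal pairs contributes
    [p j], bounded here by [p j + p j ^+ 2]. *)
Lemma ball_count_second_moment :
  (\int[P]_w (((ball_count X n j w)%:R : R) ^+ 2)%:E
   <= (n%:R * p j + (n%:R * p j) ^+ 2)%:E)%E.
Proof.
have p0 : 0 <= p j by rewrite -lee_fin -(Phit 0).
under eq_integral => w _.
  rewrite ball_countE expr2 mulr_suml -sumEFin.
  under eq_bigr do rewrite mulr_sumr -sumEFin.
  over.
rewrite ge0_integral_sum//; last 2 first.
- move=> i; apply: emeasurable_sum => l; apply/measurable_EFinP.
  by apply: measurable_funM; exact: measurable_indic.
- by move=> i w _; apply: sume_ge0 => l _; rewrite lee_fin mulr_ge0.
apply: (@le_trans _ _ (\sum_(i < n) (p j + n%:R * p j ^+ 2)%:E)%E); last first.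
  by rewrite sumEFin lee_fin sumr_const card_ord -mulr_natl; lra.
apply: lee_sum => i _.
rewrite ge0_integral_sum//; last first.
  by move=> l; apply/measurable_EFinP; apply: measurable_funM; exact: measurable_indic.
apply: (@le_trans _ _ (\sum_(l < n) ((i == l)%:R * p j + p j ^+ 2)%:E)%E).
  apply: lee_sum => l _.
  under eq_integral do rewrite -[(_ * _)%R]/((\1_(hit i) \* \1_(hit l)) _) -indicI.
  rewrite integral_indic ?setIT; [|exact: measurableT|exact: measurableI].
  have [<-|il] := eqVneq i l.
    by rewrite setIid [leLHS](Phit i) lee_fin mul1r lerDl sqr_ge0.
  by rewrite [leLHS](prob_two_hits il) lee_fin mul0r add0r.
rewrite sumEFin lee_fin big_split/= sumr_const card_ord -[_ *+ n]mulr_natl.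
rewrite (bigD1 i)//= eqxx mul1r big1 ?addr0//.
by move=> l /negPf; rewrite eq_sym => ->; rewrite mul0r.
Qed.

(** Markov's inequality. *)
Lemma prob_occupied_le :
  (P [set w | (0 < ball_count X n j w)%N] <= (n%:R * p j)%:E)%E.
Proof.
rewrite -ball_count_mean -[X in (P X <= _)%E]setIT.
have mB := measurable_ball_count [set k | (0 < k)%N].
rewrite -(integral_indic P)//; apply: ge0_le_integralT => w; rewrite lee_fin//.
rewrite indicE; case: (_ \in _) / boolP => //= /set_mem /= h.
by rewrite ler1n.
Qed.

(** Chebyshev's inequality, with the variance bounded by the mean. *)
Lemma prob_deviation_le : 0 < n%:R * p j ->
  (P [set w | (n%:R * p j <= 2 * `|(ball_count X n j w)%:R - n%:R * p j|)%R]
   <= (4 / (n%:R * p j))%:E)%E.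
Proof.
set mu := n%:R * p j => mu0; set B := [set w | _].
pose Z w : R := (ball_count X n j w)%:R.
have mB : measurable B.
  exact: (measurable_ball_count [set k | mu <= 2 * `|k%:R - mu|]).
have mZ : measurable_fun setT (EFin \o Z).
  exact: (measurable_ball_count_EFin (fun k => k%:R)).
have mZ2 : measurable_fun setT (fun w => (Z w ^+ 2)%:E).
  exact: (measurable_ball_count_EFin (fun k => k%:R ^+ 2)).
have Z0 w : 0 <= Z w by rewrite /Z.
(* Expanding (Z - mu)^2 and moving its negative term -2 mu Z to the left keeps
   every integrand nonnegative, so that the integrals split. *)
have : (\int[P]_w ((mu ^+ 2)%:E * (\1_B w)%:E + (8 * mu)%:E * (Z w)%:E) <=
        \int[P]_w (4%:E * (Z w ^+ 2)%:E + (4 * mu ^+ 2)%:E))%E.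
  apply: ge0_le_integralT => w; rewrite -!EFinM -EFinD ?lee_fin.
    apply: addr_ge0; first by rewrite mulr_ge0 ?sqr_ge0.
    by apply: mulr_ge0 => //; lra.
  rewrite indicE; have [/set_mem /= h|_] := boolP (w \in B).
    have : mu ^+ 2 <= (2 * `|Z w - mu|) ^+ 2
      by rewrite lerXn2r// nnegrE; [exact: ltW|exact: mulr_ge0].
    by rewrite [leRHS]exprMn real_normK ?num_real/=; nra.
  by have := sqr_ge0 (Z w - mu); rewrite /=; nra.
have mu2 : 0 <= mu ^+ 2 by exact: sqr_ge0.
have mu8 : 0 <= 8 * mu by lra.
have m1B : measurable_fun setT (fun w => (\1_B w : R)%:E).
  by apply/measurable_EFinP; exact: measurable_indic.
rewrite ge0_integralD//; first last.
- exact: measurable_funeM.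
- by move=> w _; rewrite -EFinM lee_fin mulr_ge0.
- exact: measurable_funeM.
- by move=> w _; rewrite -EFinM lee_fin mulr_ge0.
rewrite ge0_integralD//; first last.
- by move=> w _; rewrite lee_fin mulr_ge0.
- exact: measurable_funeM.
- by move=> w _; rewrite -EFinM lee_fin mulr_ge0 ?sqr_ge0.
rewrite (ge0_integralZl_EFin P measurableT _ m1B mu2); last first.
  by move=> w _; rewrite lee_fin.
rewrite (ge0_integralZl_EFin P measurableT _ mZ mu8); last first.
  by move=> w _; rewrite lee_fin.
rewrite (ge0_integralZl_EFin P measurableT _ mZ2 (ler0n _ 4)); last first.
  by move=> w _; rewrite lee_fin sqr_ge0.
have -> : (\int[P]_w (4 * mu ^+ 2)%:E = (4 * mu ^+ 2)%:E)%E.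
  by rewrite integral_cst// [X in (_ * X)%E](probability_setT P) mule1.
rewrite ball_count_mean -/mu.
have -> : (\int[P]_w (\1_B w)%:E = P B)%E by rewrite integral_indic ?setIT.
have [b ->] : exists b, P B = b%:E.
  by exists (fine (P B)); rewrite fineK// fin_num_measure.
move=> h; have := le_trans h (leeD2r _
  (lee_wpmul2l (ler0n _ 4 : (0 <= 4%:E)%E) ball_count_second_moment)).
rewrite -/mu -!EFinM -!EFinD !lee_fin => {}h.
by rewrite ler_pdivlMr//; nra.
Qed.

End ball_count_moments.

(** * The counting function of the probabilities *)

(** With [a] the number of balls, [a * p k] is a mean count, so evaluations of
    [rho] at [a / y] count the boxes of mean at least [y]. *)
Lemma rhoE (R : realType) (p : nat -> R) (a y : R) : 0 < a -> 0 < y ->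
  rho p (a / y) = (ncard [set k | y <= a * p k])%:R.
Proof.
move=> a0 y0; rewrite /rho; congr (ncard _)%:R; apply/seteqP.
by split => k /=; rewrite invf_div ler_pdivrMr// mulrC.
Qed.

Lemma rho_left_cardE (R : realType) (p : nat -> R) (a y : R) :
  probability_vector p -> 0 < a -> 0 < y ->
  rho_left p (a / y) = (ncard [set k | y < a * p k])%:R.
Proof.
move=> hp a0 y0; rewrite rho_leftE ?divr_gt0//; congr (ncard _)%:R; apply/seteqP.
by split => k /=; rewrite invf_div ltr_pdivrMr// mulrC.
Qed.

Lemma finite_scaled_ge (R : realType) (p : nat -> R) (a y : R) :
  probability_vector p -> 0 < a -> 0 < y -> finite_set [set k | y <= a * p k].
Proof.
move=> hp a0 y0; apply: sub_finite_set (finite_box_ge hp (divr_gt0 y0 a0)).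
by move=> k /=; rewrite ler_pdivrMr// mulrC.
Qed.

Lemma integral_inv_sqr (R : realType) (a : R) : 0 < a ->
  (\int[lebesgue_measure]_(t in `[a, +oo[) (t ^- 2)%:E = (a^-1)%:E)%E.
Proof.
move=> a0.
have dV (x : R) : 0 < x -> is_derive x 1 (fun y : R => - y^-1) (x ^- 2).
  move=> x0; have x_neq0 : id x != 0 by rewrite /= gt_eqF.
  have := is_deriveN (is_deriveV x_neq0 (is_derive_id x (1 : R))).
  by rewrite -[_ *: _]/(_ * _) mulr1 opprK.
rewrite (@ge0_continuous_FTC2y _ (fun t => t ^- 2) (fun t => - t^-1) a 0).
- by rewrite sub0e -EFinN opprK.
- by move=> x ax; rewrite invr_ge0 sqr_ge0.
- apply: derivable_within_continuous => x; rewrite in_itv/= andbT => ax.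
  have x0 : x != 0 by rewrite gt_eqF// (lt_le_trans a0).
  by apply: derivableV; rewrite ?expf_neq0.
- rewrite -oppr0; apply: cvgN; apply/gtr0_cvgV0; last exact: cvg_id.
  exact: nbhs_pinfty_gt.
- by move=> x ax; have [] := dV x (lt_trans a0 ax).
- apply: cvg_at_right_filter; apply: cvgN; apply: inv_continuous.
  by rewrite gt_eqF.
- move=> x; rewrite in_itv/= andbT => ax.
  by rewrite derive1E; have [_ ->] := dV x (lt_trans a0 ax).
Qed.

(** Layer-cake formula: [t ^- 2 * (rho p (a * t) - rho p a)] is the sum over the
    boxes with [a * p k < 1] of the function equal to [t ^- 2] for
    [t >= (a * p k)^-1] and to [0] before, and this function has integral
    [a * p k] by [integral_inv_sqr]. *)
Lemma small_mass_le_integral (R : realType) (p : nat -> R) (a : R) :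
  probability_vector p -> 0 < a ->
  (\sum_(0 <= k <oo) (if (a * p k < 1)%R then a * p k else 0)%:E
   <= \int[lebesgue_measure]_(t in `[1%R, +oo[)
        (t ^- 2 * (rho p (a * t) - rho p a))%:E)%E.
Proof.
move=> hp a0; have p0 := hp.1.
pose mu k := a * p k.
have mu0 k : 0 <= mu k by rewrite mulr_ge0// ltW.
have inv_sqr_cont : {within `[1, +oo[, continuous (fun t : R => t ^- 2)}.
  apply: derivable_within_continuous => x; rewrite in_itv/= andbT => x1.
  by apply: derivableV; rewrite ?expf_neq0// gt_eqF//; lra.
have minv_sqr : measurable_fun (`[1, +oo[ : set R) (fun t : R => (t ^- 2)%:E).
  apply/measurable_EFinP; exact: subspace_continuous_measurable_fun.
(* The times t at which box k enters the difference of the two values of rho;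
   a box with p k = 0 never does. *)
pose J k : set R := if 0 < mu k < 1 then `[(mu k)^-1, +oo[%classic else set0.
have mJ k : measurable (J k) by rewrite /J; case: ifP.
have J1 k : (`[1, +oo[ : set R) `&` J k = J k.
  apply/setIidPr; rewrite /J; case: ifP => [/andP[muk0 muk1] t|_]; last exact: sub0set.
  rewrite /= !in_itv/= !andbT; apply: le_trans.
  by rewrite invf_ge1// ltW.
pose h (i : nat) : R -> \bar R := (fun t : R => (t ^- 2)%:E) \_ (J i).
have h0 k t : (0 <= h k t)%E.
  by rewrite /h patchE; case: ifP => // _; rewrite lee_fin invr_ge0 sqr_ge0.
have -> : (\int[lebesgue_measure]_(t in `[1%R, +oo[)
             (t ^- 2 * (rho p (a * t) - rho p a))%:E =
           \int[lebesgue_measure]_(t in `[1%R, +oo[) \sum_(0 <= k <oo) h k t)%E.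
  apply: eq_integral => t /set_mem /=.
  rewrite in_itv/= andbT => t1.
  have t0 : 0 < t by lra.
  have -> : rho p (a * t) = (ncard [set k | t^-1 <= mu k])%:R.
    by rewrite -{1}[t]invrK rhoE ?invr_gt0.
  have -> : rho p a = (ncard [set k | 1 <= mu k])%:R.
    by rewrite -{1}[a]divr1 rhoE.
  have ft : finite_set [set k | t^-1 <= mu k].
    by apply: finite_scaled_ge; rewrite ?invr_gt0.
  rewrite -card_setD//; last first.
    by move=> k /=; apply: le_trans; rewrite invf_le1.
  rewrite EFinM card_nneseries; last exact: finite_setD.
  rewrite -nneseriesZl; last by move=> k _; rewrite lee_fin.
  apply: eq_eseriesr => k _; rewrite /h patchE indicE.
  have -> : (k \in [set k | t^-1 <= mu k] `\` [set k | 1 <= mu k]) = (t \in J k).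
    rewrite /J; apply/idP/idP => /set_mem; last first.
      case: ifP => [/andP[muk0 muk1]|_ []] /=.
      rewrite in_itv/= andbT => tk; apply/mem_set; split => /=.
        by rewrite -[leRHS]invrK lef_pV2// posrE invr_gt0.
      by apply/negP; rewrite -ltNge.
    move=> [/= tk /negP]; rewrite -ltNge => k1; apply/mem_set.
    have muk0 : 0 < mu k by apply: lt_le_trans tk; rewrite invr_gt0.
    rewrite muk0 k1/= in_itv/= andbT.
    by rewrite -[leRHS]invrK lef_pV2// posrE invr_gt0.
  by case: ifP => _; rewrite ?mule1 ?mule0.
rewrite integral_nneseries//; last first.
  move=> k; apply: (iffLR (measurable_restrict _ (mJ k) (measurable_itv _))).
  by apply: measurable_funS minv_sqr => //; exact: subIsetl.
apply: lee_nneseries => k _; rewrite -/(mu k).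
  by move=> _; rewrite lee_fin; case: ifP.
rewrite /h -integral_mkcondr J1 /J.
have [muk1|] := ltP (mu k) 1; last first.
  by rewrite andbF integral_set0.
have := mu0 k; rewrite le_eqVlt => /predU1P[<-|muk]; first by rewrite ltxx integral_set0.
by rewrite muk/= integral_inv_sqr ?invr_gt0// invrK.
Qed.

(** * The expected number of exceptional boxes *)

Lemma finite_occupied (T : Type) (X : nat -> T -> nat) (n : nat) (w : T) :
  finite_set [set j | (0 < ball_count X n j w)%N].
Proof.
apply: (@sub_finite_set _ _ ((fun i => X i w) @` `I_n)); last first.
  exact: finite_image.
move=> j /=; rewrite lt0n sum_nat_eq0 negb_forall => /existsP[i].
by rewrite /= eqb0 negbK => /eqP <-; exists i => /=.
Qed.

Section exceptional_count.
Context d (T : measurableType d) (R : realType) (P : probability T R).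
Variables (p : nat -> R) (X : nat -> T -> nat) (n : nat) (M : R).
Hypotheses (hp : probability_vector p) (hX : karlin_scheme P p X).
Hypotheses (n_gt0 : (0 < n)%N) (M_ge1 : 1 <= M).

Let mu k := n%:R * p k.
Let E j := [set w | exceptional mu M (fun k => ball_count X n k w) j].

Let fmu y : 0 < y -> finite_set [set k | y <= mu k].
Proof. by apply: finite_scaled_ge => //; rewrite ltr0n. Qed.

Let mE j : measurable (E j).
Proof.
exact: (@measurable_ball_count _ _ _ _ _ _ hX n j (fun z => mu j < 1 /\ (0 < z)%N \/
         M <= mu j /\ mu j <= 2 * `|z%:R - mu j|)).
Qed.

Let mindicE j : measurable_fun setT (fun w => (\1_(E j) w : R)%:E).
Proof. by apply/measurable_EFinP; exact: measurable_indic. Qed.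

Let exceptional_countE w :
  (ncard (exceptional mu M (fun k => ball_count X n k w)))%:R%:E =
  (\sum_(0 <= j <oo) (\1_(E j) w : R)%:E)%E.
Proof.
rewrite card_nneseries; last first.
  apply: finite_exceptional; last exact: finite_occupied.
  by apply: fmu; exact: lt_le_trans M_ge1.
by apply: eq_eseriesr => j _; rewrite !indicE; congr ((nat_of_bool _)%:R%:E);
  apply/idP/idP; rewrite !inE.
Qed.

Lemma measurable_exceptional_count : measurable_fun setT (fun w =>
  (ncard (exceptional (fun k => n%:R * p k) M (fun k => ball_count X n k w)))%:R%:E
  : \bar R).
Proof.
under eq_fun do rewrite exceptional_countE.
by apply: ge0_emeasurable_sum => // j w _ _; rewrite lee_fin.
Qed.

(** The expectation is the sum of the probabilities of being exceptional; a box
    with mean between [1] and [M] is never exceptional, which is why the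
    Chebyshev bound [4 / mu k] can be replaced by [4 / M]. *)
Lemma expected_exceptional_le :
  (\int[P]_w ((ncard (exceptional (fun k => n%:R * p k) M
                      (fun k => ball_count X n k w)))%:R)%:E
   <= \sum_(0 <= k <oo) (if (n%:R * p k < 1)%R then n%:R * p k else 0)%:E
      + (4 / M * (ncard [set k | (1 <= n%:R * p k)%R])%:R)%:E)%E.
Proof.
have M0 : 0 < M by exact: lt_le_trans M_ge1.
under eq_integral do rewrite exceptional_countE.
rewrite integral_nneseries//.
rewrite EFinM card_nneseries; last exact: fmu.
rewrite -nneseriesZl; last by move=> k _; rewrite lee_fin.
rewrite -nneseriesD; last 2 first.
- by move=> k _ _; rewrite lee_fin; case: ifP => // _; rewrite mulr_ge0//; exact: hp.1.
- by move=> k _ _; rewrite -EFinM lee_fin mulr_ge0// divr_ge0// ltW.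
apply: lee_nneseries => [k _ _|k _].
  by apply: integral_ge0 => w _; rewrite lee_fin.
rewrite integral_indic// setIT -EFinM -EFinD.
have [mu1|mu1] := ltP (mu k) 1.
  apply: (@le_trans _ _ (P [set w | (0 < ball_count X n k w)%N])).
    apply: le_measure; rewrite ?inE//.
      exact: (@measurable_ball_count _ _ _ _ _ _ hX n k (fun z => (0 < z)%N)).
    by move=> w [[]//|[Mmu _]]; have := le_trans M_ge1 Mmu; rewrite leNgt mu1.
  apply: (le_trans (prob_occupied_le hX n k)).
  by rewrite lee_fin lerDl mulr_ge0// divr_ge0// ltW.
rewrite add0r indicE mem_set// mulr1.
have [Mmu|muM] := leP M (mu k); last first.
  rewrite (_ : E k = set0) ?measure0 ?lee_fin ?divr_ge0// ?ltW//.
  by rewrite -subset0 => w [[]|[]] /=; rewrite ?ltNge ?mu1// leNgt muM.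
have muk0 : 0 < mu k by lra.
apply: (@le_trans _ _ (P [set w | (mu k <= 2 * `|(ball_count X n k w)%:R - mu k|)%R])).
  apply: le_measure; rewrite ?inE//.
    exact: (@measurable_ball_count _ _ _ _ _ _ hX n k (fun z => mu k <= 2 * `|z%:R - mu k|)).
  by move=> w [[]|[]//]; rewrite ltNge mu1.
apply: (le_trans (prob_deviation_le hX muk0)).
by rewrite lee_fin ler_pM2l// lef_pV2.
Qed.

End exceptional_count.

(** * The bound on the expected supremum *)

Lemma ln_nat_ge (R : realType) (n : nat) : (2 <= n)%N -> 2^-1 <= ln n%:R :> R.
Proof.
move=> n2; have : 2^-1 <= ln 2 :> R.
  have := @le_ln1Dx R (- 2^-1) ltac:(lra).
  by rewrite (_ : 1 + - 2^-1 = 2^-1 :> R) ?lnV ?posrE//; lra.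
by move=> /le_trans; apply; rewrite ler_ln ?posrE// ?ler_nat// ltr0n; apply: leq_trans n2.
Qed.

Theorem proposition4p1 (R : realType) :
  exists x0 : R, 1 < x0 /\
  forall (d : measure_display) (T : measurableType d) (P : probability T R)
    (p : nat -> R) (X : nat -> T -> nat) (n : nat),
  probability_vector p -> karlin_scheme P p X -> (2 <= n)%N ->
  ('E_P[fun w => (sup [set `|occupied_upto X n t w -
                       (rho p n%:R - rho_left p (n%:R `^ (1 - t)))|
                     | t in `[0, 1]])%R]
   <= (6 * (rho p n%:R - rho p (x0^-1 * n%:R * (ln n%:R) ^- 2)))%:E
      + (3 * rho p n%:R / ln n%:R)%:E
      + \int[lebesgue_measure]_(t in `[1%R, +oo[)
          (t ^- 2 * (rho p (n%:R * t) - rho p n%:R))%:E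
      + (2 * sup [set rho p (expR 1 * n%:R `^ (1 - t)) -
                      rho p ((expR 1)^-1 * n%:R `^ (1 - t))
                 | t in `[0, 1]])%R%:E)%E.
Proof.
exists 4; split=> [|d T P p X n hp hX n2]; first by lra.
have n0 : (0 < n)%N by exact: leq_trans n2.
have nR0 : 0 < n%:R :> R by rewrite ltr0n.
have nR1 : 1 <= n%:R :> R by rewrite ler1n.
have e2 := @expR1_ge2 R.
have e0 : 0 < (expR 1 : R) by lra.
have L2 := ln_nat_ge R n2.
set L := ln n%:R in L2 *.
have L0 : 0 < L by lra.
pose M : R := 4 * L ^+ 2.
have M1 : 1 <= M by rewrite /M; nra.
have M0 : 0 < M by lra.
pose mu k := n%:R * p k.
have fmu y : 0 < y -> finite_set [set k | y <= mu k].
  exact: finite_scaled_ge.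
have pow_gt0 t : 0 < n%:R `^ t :> R by rewrite powR_gt0.
have powB t : n%:R `^ (1 - t) = n%:R / n%:R `^ t :> R.
  rewrite powRD ?powRN ?powRr1 ?ltW//.
  by apply/implyP => _; rewrite gt_eqF.
have rho1 : rho p n%:R = (ncard [set k | 1 <= mu k])%:R.
  by rewrite -[in LHS](divr1 n%:R) rhoE.
have rhoM : rho p (4^-1 * n%:R * L ^- 2) = (ncard [set k | M <= mu k])%:R.
  by rewrite -rhoE//; congr rho; rewrite /M; field; rewrite gt_eqF.
have rholt t : rho_left p (n%:R `^ (1 - t)) = (ncard [set k | n%:R `^ t < mu k])%:R.
  by rewrite powB rho_left_cardE.
have rhoe t : rho p (expR 1 * n%:R `^ (1 - t)) =
    (ncard [set k | (expR 1)^-1 * n%:R `^ t <= mu k])%:R.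
  rewrite -rhoE// ?mulr_gt0 ?invr_gt0//; congr rho; rewrite powB; field.
  by rewrite !gt_eqF.
have rhoV t : rho p ((expR 1)^-1 * n%:R `^ (1 - t)) =
    (ncard [set k | expR 1 * n%:R `^ t <= mu k])%:R.
  rewrite -rhoE// ?mulr_gt0//; congr rho; rewrite powB; field.
  by rewrite !gt_eqF.
pose win t : R := rho p (expR 1 * n%:R `^ (1 - t)) -
                  rho p ((expR 1)^-1 * n%:R `^ (1 - t)).
set S := sup _.
have pow1 t : 0 <= t -> 1 <= n%:R `^ t :> R.
  by move=> t0; rewrite -[leLHS](powRr0 n%:R) ler_powR.
(* Without an upper bound on the window counts their sup would be the default
   value 0; all of them are at most the number of boxes of mean at least e^-1. *)
have win_le t : 0 <= t <= 1 -> win t <= S.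
  move=> t01; apply: ub_le_sup; last by exists t => //=; rewrite in_itv.
  exists (ncard [set k | (expR 1)^-1 <= mu k])%:R => _ [u /= + <-].
  rewrite in_itv/= => /andP[u0 u1]; rewrite rhoe rhoV.
  apply: (@le_trans _ _ (ncard [set k | (expR 1)^-1 * n%:R `^ u <= mu k])%:R).
    by rewrite gerBl.
  rewrite ler_nat; apply: card_subset; first by apply: fmu; rewrite invr_gt0.
  move=> k /=; apply: le_trans; rewrite ler_peMr ?pow1// ltW// invr_gt0//.
have S0 : 0 <= S.
  apply: le_trans (win_le 0 _); last by rewrite lexx ler01.
  rewrite /win rhoe rhoV subr_ge0 ler_nat; apply: card_subset.
    by apply: fmu; rewrite mulr_gt0 ?invr_gt0.
  move=> k /=; apply: le_trans; rewrite ler_wpM2r ?(ltW (pow_gt0 _))//.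
  by apply: (@le_trans _ _ 1); [rewrite invf_le1//; lra|lra].
pose D := rho p n%:R - rho p (4^-1 * n%:R * L ^- 2).
have D0 : 0 <= D.
  rewrite /D rho1 rhoM subr_ge0 ler_nat; apply: card_subset; first exact: fmu.
  by move=> k /=; exact: le_trans.
pose exc w := (ncard (exceptional mu M (fun j => ball_count X n j w)))%:R : R.
have bound w t : 0 <= t <= 1 ->
    `|occupied_upto X n t w - (rho p n%:R - rho_left p (n%:R `^ (1 - t)))|
    <= exc w + (D + S).
  move=> t01; rewrite addrA; apply: le_trans (lerD (lexx _) (win_le t t01)).
  rewrite /win /D rho1 rhoM rholt rhoe rhoV.
  apply: dist_counts_le => //; first exact: finite_occupied.
  by apply: pow1; case/andP: t01.
rewrite unlock.
have Xub w : has_ubound [set `|occupied_upto X n t w -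
    (rho p n%:R - rho_left p (n%:R `^ (1 - t)))| | t in `[0, 1]].
  by exists (exc w + (D + S)) => _ [t /= + <-]; rewrite in_itv/=; exact: bound.
apply: (@le_trans _ _ (\int[P]_w ((exc w)%:E + (D + S)%:E))%E).
  apply: ge0_le_integralT => w; rewrite ?lee_fin -?EFinD ?lee_fin.
    apply: (@le_trans _ _ `|occupied_upto X n 0 w -
       (rho p n%:R - rho_left p (n%:R `^ (1 - 0)))|) => //.
    by apply: ub_le_sup => //; exists 0 => //=; rewrite in_itv/= lexx ler01.
  apply: ge_sup; last by move=> _ [t /= + <-]; rewrite in_itv/=; exact: bound.
  eexists; exists 0; last reflexivity.
  by rewrite /= in_itv/= lexx ler01.
have mexc : measurable_fun setT (fun w => (exc w)%:E).
  exact: (measurable_exceptional_count hp hX n0 M1).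
rewrite ge0_integralD//; last 2 first.
- by move=> w _; rewrite lee_fin.
- by move=> w _; rewrite lee_fin addr_ge0.
have -> : (\int[P]_w (D + S)%:E = (D + S)%:E)%E.
  by rewrite integral_cst// [X in (_ * X)%E](probability_setT P) mule1.
have := expected_exceptional_le hp hX n0 M1.
rewrite -rho1 => /(leeD2r (D + S)%:E)/le_trans; apply.
apply: le_trans (leeD2r _ (leeD2r _ (small_mass_le_integral hp nR0))) _.
rewrite [leRHS]addeAC -!EFinD [leRHS]addeC -addeA -EFinD.
apply: leeD2l; rewrite lee_fin -/D.
have rho0 : 0 <= rho p n%:R by rewrite rho1.
(* 4 / M = L^-2 <= 2 / L because L >= 1/2. *)
have : 4 / M * rho p n%:R <= 3 * rho p n%:R / L.
  rewrite [leRHS]mulrAC ler_wpM2r// /M ler_pdivlMr//.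
  rewrite (_ : 4 / (4 * L ^+ 2) * L = L^-1); last by field; rewrite gt_eqF.
  by apply: (@le_trans _ _ 2); [rewrite invf_ple ?posrE|]; lra.
lra.
Qed.
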